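(* Consider, for $x\ge0$, the planar piecewise-smooth (Filippov) system $$\dot x=1,\qquad \dot y=-ay-\big[1+(1+\lambda)\cos\pi x\big]\sin\tfrac{\pi x}{2},$$ with $\lambda=\operatorname{sign}(y)$ for $y\ne0$ and $\lambda\in(-1,1)$ on $y=0$. There exists $a_h>0$, $a_h\gg1$, such that for all $a\in(a_h,+\infty)$ the system has a sliding $4$-periodic solution. Moreover, for every $a\in(a_h,+\infty)$ there exists $\nu(a)>0$ such that the solutions $y(x,x_i)$ of the system with $x_i\in(\frac83,\frac{10}{3})\cup(\frac{10}{3},\frac{10}{3}+\nu(a))$ converge in finite time to the periodic solution $y(x,\frac{10}{3})$ (i.e. coincide with it for all sufficiently large $x$).
   Context: $y(x,x_i)$ denotes the solution with $y(x_i)=0$. For $y>0$ the system is $\dot y=-ay-\sin(3\pi x/2)$ and for $y<0$ it is $\dot y=-ay-\sin(\pi x/2)$. The sliding manifold is $\Lambda^L=\{(x,0): x\in(\frac23+2n,\frac43+2n),\ n\in\mathbb{N}\}$; on the intervals $(\frac83+4n,\frac{10}{3}+4n)$ both vector fields point towards $y=0$ (attracting sliding: solutions reaching $y=0$ there remain on it with $\dot x=1$ until the right endpoint, where they leave into $y>0$), on $(\frac23+4n,\frac43+4n)$ both point away (repelling), and elsewhere on $y=0$ solutions cross transversally (Filippov convention). A periodic solution is sliding if part of it lies on $\Lambda^L$. *)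

(* Defs.v *)
From HB Require Import structures.
From mathcomp Require Import all_boot all_order all_algebra.
From mathcomp Require Import all_classical all_reals all_analysis.
Set Implicit Arguments. Unset Strict Implicit. Unset Printing Implicit Defensive.
Import Order.TTheory GRing.Theory Num.Theory.
Local Open Scope classical_set_scope.
Local Open Scope ring_scope.

Definition rhs {R : realType} (a lam x y : R) : R :=
  - a * y - (1 + (1 + lam) * cos (pi * x)) * sin (pi * x / 2).

Definition admissible {R : realType} (lam y : R) : Prop :=
  (0 < y /\ lam = 1) \/ (y < 0 /\ lam = -1) \/ (y = 0 /\ -1 < lam < 1).

(* Filippov solution on [x0, +oo): y is absolutely continuous on every
   [x0, x], i.e. the indefinite Lebesgue integral of some locally integrable g,
   and a.e. on [x0,+oo) its derivative g lies in the Filippov set F(x, y(x)). *)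
Definition filippov_sol {R : realType} (a x0 : R) (y : R -> R) : Prop :=
  exists g : R -> R,
    (forall x, x0 <= x ->
       (@lebesgue_measure R).-integrable `[x0, x] (EFin \o g)) /\
    (forall x, x0 <= x ->
       ((y x - y x0)%:E = \int[@lebesgue_measure R]_(s in `[x0, x]) (g s)%:E)%E) /\
    {ae @lebesgue_measure R, forall s, x0 <= s ->
       exists lam, admissible lam (y s) /\ g s = rhs a lam s (y s)}.

Definition sol_from {R : realType} (a xi : R) (y : R -> R) : Prop :=
  filippov_sol a xi y /\ y xi = 0.

Definition in_LambdaL {R : realType} (x : R) : Prop :=
  exists n : nat, 2 / 3 + 2 * n%:R < x < 4 / 3 + 2 * n%:R.

Definition sliding {R : realType} (x0 : R) (y : R -> R) : Prop :=
  exists c d : R, x0 <= c /\ c < d /\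
    forall x, c < x < d -> y x = 0 /\ in_LambdaL x.

Definition periodic_on {R : realType} (x0 T : R) (y : R -> R) : Prop :=
  forall x, x0 <= x -> y (x + T) = y x.

(* Main.v *)
Require Import Defs.
From HB Require Import structures.
From mathcomp Require Import all_boot all_order all_algebra.
From mathcomp Require Import all_classical all_reals all_analysis.
From mathcomp Require Import measurable_realfun ring lra.
Import Order.TTheory GRing.Theory Num.Theory.
Import numFieldNormedType.Exports.
Set Implicit Arguments. Unset Strict Implicit. Unset Printing Implicit Defensive.
Local Open Scope ring_scope.

(** Away from [y = 0] the equation is linear, so with [F] the forcing of the
    current half plane and [p] its periodic steady state, a solution leaving
    [y = 0] at [c] equals [p x - exp (- a (x - c)) p c] until its next zero.
    Started in [10/3, 4), a solution crosses upwards, returns to 0 at some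
    [t1] in (4, 14/3), crosses downwards, returns at [t2] in (6, 20/3), crosses
    upwards, and returns at [t3] in (20/3, 22/3), inside the attracting sliding
    segment, on which it stays until [22/3 = 10/3 + 4].  Hence every such
    solution is at 0 at [22/3], which yields the cycle, its uniqueness and the
    finite-time convergence with [nu = 2/3].  The upward excursions return in
    time because the steady state takes the same negative value at both ends of
    [10/3, 14/3] and of [6, 22/3]; only the downward one, which has to end
    before [20/3], needs [a > pi / sin (pi / 3)]. *)

(** * Continuity, mean values and extremal zeros on the real line *)

Lemma continuous_near_gt (R : realType) (f : R -> R) (x l : R) :
  {for x, continuous f} -> l < f x ->
  exists2 d, 0 < d & forall z, x - d < z < x + d -> l < f z.
Proof.
move=> cf lf; have e0 : 0 < f x - l by lra.
move/cvgrPdist_lt : cf => /(_ _ e0)[d /= d0 dP]; exists d => // z zd.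
have : ball x d z by rewrite /ball /= ltr_norml; lra.
by move=> /dP /=; rewrite ltr_norml; lra.
Qed.

Lemma continuous_MVT (R : realType) (f df : R -> R) (c d : R) :
  continuous f -> c < d ->
  (forall x, c < x < d -> is_derive x 1 f (df x)) ->
  exists2 x, c < x < d & f d - f c = df x * (d - c).
Proof.
move=> cf cd fdf; have fdf' x : x \in `]c, d[ -> is_derive x 1 f (df x).
  by rewrite in_itv => /fdf.
have [x] := MVT cd fdf' (continuous_subspaceT cf).
by rewrite in_itv => xcd fE; exists x.
Qed.

(** The zero is the supremum of the points of [[c, d]] where [y <= 0]; continuity excludes either
    strict sign there. *)
Lemma last_zero (R : realType) (y : R -> R) (c d : R) :
  continuous y -> c < d -> y c <= 0 -> 0 < y d ->
  exists2 z, c <= z < d & y z = 0 /\ forall x, z < x <= d -> 0 < y x.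
Proof.
move=> cy cd yc yd; pose S : set R := [set x | c <= x <= d /\ y x <= 0]%classic.
have Sc : S c by split => //; lra.
have hS : has_sup S by split; [exists c | exists d => x [? _]; lra].
have ubS x : S x -> x <= sup S by move=> Sx; exact: sup_upper_bound.
have cs : c <= sup S := ubS _ Sc.
have sd : sup S <= d by apply: ge_sup; [exists c | move=> x [? _]; lra].
(* If [y] were positive at the supremum, it would be positive on a whole neighbourhood, which
   contains points of [S]. *)
have ys0 : y (sup S) <= 0.
  rewrite leNgt; apply/negP => /(continuous_near_gt (cy _))[e e0 eP].
  have [x Sx xe] := sup_adherent e0 hS.
  have xs := ubS _ Sx; have /eP : sup S - e < x < sup S + e by lra.
  by rewrite ltNge Sx.2.
have sd' : sup S < d.
  by rewrite lt_neqAle sd andbT; apply: contraTneq yd => <-; rewrite -leNgt.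
have pos x : sup S < x <= d -> 0 < y x.
  move=> xs; rewrite ltNge; apply/negP => yx.
  have : x <= sup S by apply: ubS; split => //; lra.
  lra.
exists (sup S); first lra.
split=> //; apply/eqP; rewrite eq_le ys0 /= leNgt; apply/negP => ysn.
have cN : {for sup S, continuous (fun x => - y x)} by apply: cvgN; exact: cy.
have [|e e0 eP] := @continuous_near_gt _ _ (sup S) 0 cN; first by lra.
(* A point to the right of the supremum, still in [[c, d]] and inside the window where [y] would be
   negative, against [pos]. *)
pose x := Num.min d (sup S + e / 2).
have xs : sup S < x by rewrite lt_min sd'; lra.
have xd : x <= d by rewrite ge_min lexx.
have xe : x <= sup S + e / 2 by rewrite ge_min lexx orbT.
have := pos x; have := eP x; lra.
Qed.

(** Mirror image of [last_zero] under [x -> - x]. *)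
Lemma first_zero (R : realType) (y : R -> R) (c d : R) :
  continuous y -> c < d -> 0 < y c -> y d <= 0 ->
  exists2 z, c < z <= d & y z = 0 /\ forall x, c <= x < z -> 0 < y x.
Proof.
move=> cy cd yc yd.
have cyN : continuous (fun x => y (- x)).
  move=> x; apply: (@continuous_comp _ _ _ -%R y); last exact: cy.
  exact: opp_continuous.
have [||| z zcd [yz zP]] := @last_zero _ _ (- d) (- c) cyN.
- lra.
- by rewrite opprK.
- by rewrite opprK.
- exists (- z); first lra.
  by split=> // x xz; have := zP (- x); rewrite opprK; apply; lra.
Qed.

(** * Integral-free form of the Filippov dynamics, its symmetries and its behaviour on [y = 0] *)

(* The part of the dynamics seen from [y >= 0], as classical statements free of
   Lebesgue integrals: the equation where [y > 0], and upward crossing at a zero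
   where both vector fields point up.  The part seen from [y <= 0] is the same
   predicate for [- y], see [pw_sol]. *)
Definition upper_sol (R : realType) (a : R) (Fp Fm : R -> R) (x0 : R)
    (y : R -> R) : Prop :=
  (forall x, x0 < x -> 0 < y x -> is_derive x 1 y (Fp x - a * y x)) /\
  (forall x, x0 < x -> y x = 0 -> 0 < Fp x -> 0 < Fm x ->
     exists2 d, 0 < d & forall z, x - d < z < x -> y z < 0).

Definition pw_sol (R : realType) (a : R) (Fp Fm : R -> R) (x0 : R)
    (y : R -> R) : Prop :=
  [/\ continuous y, upper_sol a Fp Fm x0 y &
      upper_sol a (\- Fm) (\- Fp) x0 (\- y)].

(** Reflection in [y = 0] swaps the half planes, so the forcings trade places and change sign.
    Results proved above the axis thereby serve below it. *)
Lemma pw_solN (R : realType) (a : R) (Fp Fm : R -> R) (x0 : R) (y : R -> R) :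
  pw_sol a Fp Fm x0 y -> pw_sol a (\- Fm) (\- Fp) x0 (\- y).
Proof.
case=> cy uy ly; split => //; first by move=> x; apply: cvgN; exact: cy.
have NN (f : R -> R) : \- (\- f) = f by apply/funext => x /=; rewrite opprK.
by rewrite !NN.
Qed.

(** Pulls a solution back by one period, so that induction on the number of periods can restart at
    the same abscissa. *)
Lemma pw_sol_shift (R : realType) (a : R) (Fp Fm : R -> R) (x0 T : R)
    (y : R -> R) :
  (forall x, Fp (x + T) = Fp x) -> (forall x, Fm (x + T) = Fm x) ->
  pw_sol a Fp Fm x0 y -> pw_sol a Fp Fm (x0 - T) (fun x => y (x + T)).
Proof.
have upper_shift (Gp Gm z : R -> R) : (forall x, Gp (x + T) = Gp x) ->
    (forall x, Gm (x + T) = Gm x) -> upper_sol a Gp Gm x0 z ->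
    upper_sol a Gp Gm (x0 - T) (fun x => z (x + T)).
  move=> pp pm [dz uz]; split => x x0x.
    move=> zx; have /dz/(_ zx) : x0 < x + T by lra.
    rewrite pp => dzx.
    have dT : is_derive x 1 (fun x : R => x + T) 1.
      by apply: is_derive_eq (addr0 _).
    have := @is_derive1_comp _ z (fun x => x + T) x _ _ dzx dT.
    by rewrite mulr1.
  rewrite -pp -pm => zx Gp0 Gm0.
  have [|d d0 dP] := uz (x + T) _ zx Gp0 Gm0; first by lra.
  by exists d => // w wx; apply: dP; lra.
move=> pp pm [cy uy ly]; split.
- move=> x; apply: (@continuous_comp _ _ _ (fun x => x + T) y); last exact: cy.
  by apply: cvgD; [exact: cvg_id | exact: cvg_cst].
- exact: upper_shift.
- apply: (@upper_shift _ _ (\- y)) => // x /=; first by rewrite pm.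
  by rewrite pp.
Qed.

(** Barrier argument: were [y x > 0], then after its last zero [y] would rise while its slope
    [Fp - a y] is negative, contradicting the mean value theorem. *)
Lemma pw_sol_le0 (R : realType) (a : R) (Fp Fm : R -> R) (x0 : R)
    (y : R -> R) (c d : R) :
  0 < a -> pw_sol a Fp Fm x0 y -> x0 <= c ->
  (forall x, c < x < d -> Fp x <= 0) ->
  y c <= 0 -> forall x, c <= x <= d -> y x <= 0.
Proof.
move=> a0 [cy [dy _] _] x0c Fp0 yc x xcd; rewrite leNgt; apply/negP => yx.
have cx : c < x.
  rewrite lt_neqAle; apply/andP; split; last by lra.
  by apply: contraTneq yx => <-; rewrite -leNgt.
have [z zcx [yz zP]] := last_zero cy cx yc yx.
have zx : z < x by lra.
have [|w wzx] := @continuous_MVT _ _ (fun w => Fp w - a * y w) z x cy zx.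
  by move=> w wzx; apply: dy; [lra | apply: zP; lra].
have : Fp w <= 0 by apply: Fp0; lra.
have : 0 < y w by apply: zP; lra.
move=> yw Fw; rewrite yz; have := mulr_gt0 a0 yw; nra.
Qed.

Section pw_sol_theory.
Context {R : realType}.
Variables (a : R) (Fp Fm : R -> R) (x0 : R) (y : R -> R).
Hypotheses (a0 : 0 < a) (sy : pw_sol a Fp Fm x0 y).

Lemma pw_sol_ge0 c d : x0 <= c -> (forall x, c < x < d -> 0 <= Fm x) ->
  0 <= y c -> forall x, c <= x <= d -> 0 <= y x.
Proof.
move=> x0c Fm0 yc x xcd; rewrite -oppr_le0.
apply: (pw_sol_le0 a0 (pw_solN sy) x0c (d := d)) => //=.
  by move=> w /Fm0; rewrite oppr_le0.
by rewrite oppr_le0.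
Qed.

(** Attracting sliding: the axis is a barrier from both sides at once. *)
Lemma pw_sol_sliding c d : x0 <= c ->
  (forall x, c < x < d -> Fp x <= 0 <= Fm x) ->
  y c = 0 -> forall x, c <= x <= d -> y x = 0.
Proof.
move=> x0c F0 yc x xcd; apply/eqP; rewrite eq_le.
rewrite (pw_sol_le0 a0 sy x0c (d := d)) ?yc//; last by move=> w /F0/andP[].
by rewrite (@pw_sol_ge0 c d)// ?yc//; move=> w /F0/andP[].
Qed.

(** The barrier gives [y >= 0]; an interior zero would be an upward crossing, preceded by negative
    values. *)
Lemma pw_sol_crossing c d : x0 <= c ->
  (forall x, c < x < d -> 0 < Fp x /\ 0 < Fm x) ->
  y c = 0 -> forall x, c < x < d -> 0 < y x.
Proof.
move=> x0c F0 yc x xcd.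
have ge0 z : c <= z <= d -> 0 <= y z.
  by apply: pw_sol_ge0 => //; [move=> w /F0[_ /ltW] | rewrite yc].
rewrite lt_neqAle ge0 ?andbT; last lra.
apply/eqP => /esym yx; case: sy => _ [_ /(_ x)] + _.
have [Fpx Fmx] := F0 x xcd.
case=> //; first lra.
move=> e e0 eP; pose z := Num.max ((c + x) / 2) (x - e / 2).
have zc : (c + x) / 2 <= z by rewrite le_max lexx.
have ze : x - e / 2 <= z by rewrite le_max lexx orbT.
have zx : z < x by rewrite gt_max; lra.
have := eP z; have := ge0 z; lra.
Qed.

End pw_sol_theory.

(** * The linear equation off the axis: integrating factor and excursions *)

Lemma is_derive_scale (R : realType) (k : R) (f : R -> R) (x df : R) :
  is_derive x 1 f df -> is_derive x 1 (fun x => k * f x) (k * df).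
Proof. exact: is_deriveZ. Qed.

Lemma is_derive_affine (R : realType) (k c x : R) :
  is_derive x 1 (fun x => k * (x - c)) k.
Proof.
rewrite -[X in is_derive _ _ _ X]mulr1; apply: is_derive_scale.
exact: is_derive_eq (subr0 _).
Qed.

Lemma is_derive_continuous (R : realType) (f df : R -> R) :
  (forall x : R, is_derive x 1 f (df x)) -> continuous f.
Proof.
move=> dfx x; apply/differentiable_continuous/derivable1_diffP.
exact: (@ex_derive _ _ _ _ _ _ _ (dfx x)).
Qed.

(** Mean value theorem for [expR (a * x) * z x], whose derivative is [expR (a * x) * h x]. *)
Lemma linear_ode_increment (R : realType) (a : R) (z h : R -> R) (c d : R) :
  continuous z -> c < d ->
  (forall x, c < x < d -> is_derive x 1 z (h x - a * z x)) ->
  exists2 x, c < x < d &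
    expR (a * d) * z d - expR (a * c) * z c = expR (a * x) * h x * (d - c).
Proof.
move=> cz cd dz.
have dE (x : R) : is_derive x 1 (fun x => expR (a * x)) (a * expR (a * x)).
  have := is_derive_affine a 0 x; under eq_fun do rewrite subr0.
  move=> da; have := is_derive1_comp (is_derive_expR _) da.
  by rewrite mulrC.
have cE := is_derive_continuous dE.
apply: (@continuous_MVT _ (fun x => expR (a * x) * z x)) => //.
  by move=> x; apply: cvgM; [exact: cE | exact: cz].
move=> x /dz dzx; have := is_deriveM (dE x) dzx.
move/is_derive_eq; apply; rewrite /GRing.scale/=; ring.
Qed.

(* When [p' = F - a p], this is the solution of [z' = F - a z], [z c = 0]. *)
Definition relax (R : realType) (a : R) (p : R -> R) (c x : R) : R :=
  p x - expR (- a * (x - c)) * p c.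

Section relax_theory.
Context {R : realType}.
Variables (a : R) (F p : R -> R).
Hypothesis dp : forall x : R, is_derive x 1 p (F x - a * p x).

Lemma relaxcc c : relax a p c c = 0.
Proof. by rewrite /relax subrr mulr0 expR0 mul1r subrr. Qed.

(** Relaxations with different starting points differ by a solution of the homogeneous equation. *)
Lemma relax_rebase b c x :
  relax a p c x = relax a p b x - expR (- a * (x - c)) * relax a p b c.
Proof.
rewrite /relax.
have -> : expR (- a * (x - b)) = expR (- a * (x - c)) * expR (- a * (c - b)).
  by rewrite -expRD; congr expR; ring.
ring.
Qed.

Lemma is_derive_relax (c x : R) :
  is_derive x 1 (relax a p c) (F x - a * relax a p c x).
Proof.
have dE := is_derive1_comp (is_derive_expR _) (is_derive_affine (- a) c x).
have dM : is_derive x 1 (fun x => expR (- a * (x - c)) * p c)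
    (- a * expR (- a * (x - c)) * p c).
  have := is_derive_scale (p c) dE; under eq_fun do rewrite mulrC.
  by move/is_derive_eq; apply; rewrite /=; ring.
apply: is_derive_eq (is_deriveB (dp x) dM) _.
rewrite /relax; ring.
Qed.

Lemma continuous_relax c : continuous (relax a p c).
Proof. exact: is_derive_continuous (is_derive_relax c). Qed.

Lemma relax_gt0 b m : (forall x, b < x < m -> 0 < F x) ->
  forall x, b < x <= m -> 0 < relax a p b x.
Proof.
move=> F0 x xm; have bx : b < x by lra.
have [w wx] := linear_ode_increment (continuous_relax (c := b)) bx
  (fun x _ => is_derive_relax b x).
rewrite relaxcc mulr0 subr0 => E.
have Fw : 0 < F w by apply: F0; lra.
rewrite -(pmulr_rgt0 _ (expR_gt0 (a * x))) E.
by rewrite !mulr_gt0 ?expR_gt0// subr_gt0.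
Qed.

(** By [relax_rebase], delaying the start from [b] to [c] subtracts a nonnegative quantity from the
    value at [e]. One sign check for the earliest start [b] therefore settles every start before
    [m]; the zero lies between the positive value at [m] and the negative one at [e]. *)
Lemma relax_excursion b c m e : b <= c -> c < m -> m < e ->
  (forall x, b < x < m -> 0 < F x) -> relax a p b e < 0 ->
  exists t, [/\ m < t < e, relax a p c t = 0 &
    forall x, c < x < t -> 0 < relax a p c x].
Proof.
move=> bc cm me F0 be0.
have Fc0 x : c < x < m -> 0 < F x by move=> xcm; apply: F0; lra.
have bc0 : 0 <= relax a p b c.
  case: (ltgtP b c) bc => // [bc _|<- _]; last by rewrite relaxcc.
  by apply/ltW/(relax_gt0 F0); lra.
have ce0 : relax a p c e < 0.
  rewrite (relax_rebase b); have := mulr_ge0 (expR_ge0 (- a * (e - c))) bc0.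
  lra.
have cm0 : 0 < relax a p c m by apply: (relax_gt0 Fc0); lra.
have [t tme [t0 tP]] := first_zero (continuous_relax (c := c)) me cm0 (ltW ce0).
exists t; split=> //.
  have te : t != e by apply: contraTneq ce0 => <-; rewrite t0 ltxx.
  have : t < e by rewrite lt_neqAle te; lra.
  lra.
move=> x xct; case: (leP m x) => mx; first by apply: tP; lra.
by apply: (relax_gt0 Fc0); lra.
Qed.

(** While [y > 0] both functions solve the same linear equation, so they agree. Hence [y] cannot
    vanish before [t]: at its first zero it would equal a positive relaxation value. *)
Lemma pw_sol_relax (Fm : R -> R) (x0 : R) (y : R -> R) (c m t : R) :
  pw_sol a F Fm x0 y -> x0 <= c -> y c = 0 -> c < m ->
  (forall x, c < x < m -> 0 < y x) ->
  (forall x, c < x < t -> 0 < relax a p c x) ->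
  forall x, c <= x <= t -> y x = relax a p c x.
Proof.
move=> [cy [dy _] _] x0c yc cm ym pt.
have agree d : c < d -> (forall x, c < x < d -> 0 < y x) ->
    y d = relax a p c d.
  move=> cd yd.
  have [|||w wcd] := @linear_ode_increment _ a (fun x => y x - relax a p c x)
      (fun=> 0) c d.
  - by move=> x; apply: cvgB; [exact: cy | exact: continuous_relax].
  - by [].
  - move=> x xcd; have dyx := dy x _ (yd x xcd).
    have x0x : x0 < x by lra.
    apply: is_derive_eq (is_deriveB (dyx x0x) (is_derive_relax c x)) _.
    ring.
  rewrite yc relaxcc !(subrr, mulr0, mul0r, subr0) => /eqP.
  rewrite mulf_eq0 (gt_eqF (expR_gt0 _)) /= subr_eq0.
  by move/eqP.
have yt x : c < x < t -> 0 < y x.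
  move=> xct; rewrite ltNge; apply/negP => yx.
  have mx : m <= x by rewrite leNgt; apply/negP => xm; have := ym x; lra.
  (* [y] vanishes at [c] itself, so the search for the first later zero starts at a point where [y]
     is known to be positive. *)
  pose u := (c + m) / 2; have yu : 0 < y u by apply: ym; rewrite /u; lra.
  have ux : u < x by rewrite /u; lra.
  have [z zux [yz zP]] := first_zero cy ux yu yx.
  have cz : c < z by move: zux; rewrite /u; lra.
  have : 0 < relax a p c z by apply: pt; lra.
  rewrite -agree ?yz ?ltxx// => w wcz; case: (leP u w) => uw.
    by apply: zP; lra.
  by apply: ym; move: uw; rewrite /u; lra.
move=> x xct; have [cx|xc|<-] := ltgtP c x; last by rewrite yc relaxcc.
- by apply: agree => // w wcx; apply: yt; lra.
- lra.
Qed.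

End relax_theory.

(** * Signs of the sine, the forcing and its steady state *)

Lemma sin_sgn_gt0 (R : realType) (k : nat) (z : R) :
  k%:R * pi < z < k.+1%:R * pi -> 0 < (-1) ^+ k * sin z.
Proof.
move=> zk; have -> : z = (z - pi *+ k) + pi *+ k by ring.
rewrite (alternatingn (@sinDpi R)) mulrA -exprD addnn.
rewrite -signr_odd odd_double expr0 mul1r; apply: sin_gt0_pi.
move: zk; rewrite -natr1 -mulr_natl; lra.
Qed.

Lemma sin_mulrn_pi (R : realType) (k : nat) : sin (pi *+ k) = 0 :> R.
Proof. by rewrite -[X in sin X]add0r (alternatingn (@sinDpi R)) sin0 mulr0. Qed.

Lemma cos_mulrn_pi (R : realType) (k : nat) : cos (pi *+ k) = (-1) ^+ k :> R.
Proof. by rewrite -[X in cos X]add0r (alternatingn (@cosDpi R)) cos0 mulr1. Qed.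

Definition forcing (R : realType) (w x : R) : R := - sin (w * x).

(* The periodic solution of [z' = - a z - sin (w x)]. *)
Definition steady (R : realType) (a w x : R) : R :=
  (w * cos (w * x) - a * sin (w * x)) / (a ^+ 2 + w ^+ 2).

Lemma is_derive_steady (R : realType) (a w x : R) : a != 0 ->
  is_derive x 1 (steady a w) (forcing w x - a * steady a w x).
Proof.
move=> a0; have D0 : a ^+ 2 + w ^+ 2 != 0.
  by rewrite gt_eqF// ltr_pwDl ?sqr_ge0// exprn_even_gt0.
have dw := is_derive_affine w 0 x.
have dc := is_derive_scale w (is_derive1_comp (is_derive_cos _) dw).
have ds := is_derive_scale a (is_derive1_comp (is_derive_sin _) dw).
have := is_derive_scale (a ^+ 2 + w ^+ 2)^-1 (is_deriveB dc ds).
under eq_fun do rewrite /= !fctE /= subr0 mulrC.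
move/is_derive_eq; apply; rewrite /steady /forcing subr0; field.
exact: D0.
Qed.

(** * The three excursions and the sliding phase for large [a] *)

Section sliding_cycle.
Context {R : realType}.
Variable a : R.
Hypothesis a_large : pi / sin (pi / 3) < a.

Let wp : R := 3 * pi / 2.
Let wm : R := pi / 2.

Let pi0 : 0 < pi :> R. Proof. exact: pi_gt0. Qed.

Let sin60 : 0 < sin (pi / 3) :> R.
Proof. by apply: sin_gt0_pi; have := pi0; lra. Qed.

Let a0 : 0 < a. Proof. exact: lt_trans (divr_gt0 _ _) a_large. Qed.

(** Here [k] numbers the half-waves, of length [2 / 3] for [wp] and [2] for [wm]; each later sign
    check only has to name its half-wave. *)
Let forcing_p_gt0 (k : nat) (x : R) : odd k ->
  2 / 3 * k%:R < x < 2 / 3 * (k%:R + 1) -> 0 < forcing wp x.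
Proof.
move=> ok xk; have := @sin_sgn_gt0 _ k (wp * x); rewrite -signr_odd ok /= expr1.
rewrite /forcing mulN1r; apply.
have -> : wp * x = (3 / 2 * x) * pi by rewrite /wp; field.
by rewrite !ltr_pM2r// -(natr1 k); lra.
Qed.

Let forcing_p_lt0 (k : nat) (x : R) : ~~ odd k ->
  2 / 3 * k%:R < x < 2 / 3 * (k%:R + 1) -> forcing wp x < 0.
Proof.
move=> /negbTE ok xk; have := @sin_sgn_gt0 _ k (wp * x).
rewrite -signr_odd ok /= expr0 /forcing mul1r oppr_lt0; apply.
have -> : wp * x = (3 / 2 * x) * pi by rewrite /wp; field.
by rewrite !ltr_pM2r// -(natr1 k); lra.
Qed.

Let forcing_m_gt0 (k : nat) (x : R) : odd k ->
  2 * k%:R < x < 2 * (k%:R + 1) -> 0 < forcing wm x.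
Proof.
move=> ok xk; have := @sin_sgn_gt0 _ k (wm * x); rewrite -signr_odd ok /= expr1.
rewrite /forcing mulN1r; apply.
have -> : wm * x = (x / 2) * pi by rewrite /wm; field.
by rewrite !ltr_pM2r// -(natr1 k); lra.
Qed.

Let forcing_m_lt0 (k : nat) (x : R) : ~~ odd k ->
  2 * k%:R < x < 2 * (k%:R + 1) -> forcing wm x < 0.
Proof.
move=> /negbTE ok xk; have := @sin_sgn_gt0 _ k (wm * x).
rewrite -signr_odd ok /= expr0 /forcing mul1r oppr_lt0; apply.
have -> : wm * x = (x / 2) * pi by rewrite /wm; field.
by rewrite !ltr_pM2r// -(natr1 k); lra.
Qed.

Let dp x : is_derive (x : R) 1 (steady a wp) (forcing wp x - a * steady a wp x).
Proof. by apply: is_derive_steady; rewrite gt_eqF. Qed.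

Let dm x : is_derive (x : R) 1 (steady a wm) (forcing wm x - a * steady a wm x).
Proof. by apply: is_derive_steady; rewrite gt_eqF. Qed.

Let dmN x : is_derive (x : R) 1 (\- steady a wm)
  ((\- forcing wm) x - a * (\- steady a wm) x).
Proof. by apply: is_derive_eq (is_deriveN (dm x)) _; rewrite /=; ring. Qed.

Lemma relaxN (p : R -> R) c x : relax a (\- p) c x = - relax a p c x.
Proof. rewrite /relax /=; ring. Qed.

Let den_gt0 (w : R) : 0 < a ^+ 2 + w ^+ 2.
Proof. by rewrite ltr_pwDl ?sqr_ge0// exprn_gt0. Qed.

(** Meant on [[c, 22 / 3]]; the final [0] is the sliding phase. *)
Definition sliding_orbit (c t1 t2 t3 x : R) : R :=
  if x <= t1 then relax a (steady a wp) c x else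
  if x <= t2 then relax a (steady a wm) t1 x else
  if x <= t3 then relax a (steady a wp) t2 x else 0.

(** Only the excursions are recorded: with [t3 < 22 / 3], sliding at 0 up to [22 / 3] closes the
    cycle started at [10 / 3]. *)
Definition is_cycle (c t1 t2 t3 : R) : Prop :=
  [/\ relax a (steady a wp) c t1 = 0 /\
         forall x, c < x < t1 -> 0 < relax a (steady a wp) c x,
      relax a (steady a wm) t1 t2 = 0 /\
         forall x, t1 < x < t2 -> relax a (steady a wm) t1 x < 0 &
      relax a (steady a wp) t2 t3 = 0 /\
         forall x, t2 < x < t3 -> 0 < relax a (steady a wp) t2 x].

(** At odd multiples of [pi] the sine vanishes and the cosine is [-1], so the steady state has the
    same negative value at both ends, multiplied here by [1 - expR (- a * (e - b)) > 0]. *)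
Lemma relax_p_lt0 (k l : nat) (b e : R) : odd k -> odd l ->
  wp * b = pi *+ k -> wp * e = pi *+ l -> b < e ->
  relax a (steady a wp) b e < 0.
Proof.
move=> ok ol kE lE be; rewrite /relax /steady kE lE !sin_mulrn_pi !cos_mulrn_pi.
rewrite -(signr_odd _ k) -(signr_odd _ l) ok ol /= !mulr0 !subr0 expr1.
have -> (r s u : R) : u * -1 / s - r * (u * -1 / s) = - ((1 - r) * (u / s)).
  by ring.
rewrite oppr_lt0 mulr_gt0 ?divr_gt0 ?den_gt0//; last first.
  by rewrite /wp; have := pi0; lra.
by rewrite subr_gt0 expR_lt1 mulNr oppr_lt0 mulr_gt0 ?subr_gt0.
Qed.

(** Up to a positive denominator the value is [a sin (pi / 3) - wm cos (pi / 3) - wm E] with [E < 1]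
    the exponential. The subtracted terms are together below [2 wm = pi], which is where the
    threshold on [a] comes from. *)
Lemma relax_m_gt0 : 0 < relax a (steady a wm) 4 (20 / 3).
Proof.
rewrite /relax /steady.
have -> : wm * 4 = pi *+ 2 by rewrite /wm; field.
have -> : wm * (20 / 3) = pi / 3 + pi *+ 3 by rewrite /wm; field.
rewrite sin_mulrn_pi cos_mulrn_pi (alternatingn (@sinDpi R)).
rewrite (alternatingn (@cosDpi R)) mulr0 subr0.
have -> : (-1) ^+ 2 = 1 :> R by ring.
have -> : (-1) ^+ 3 = -1 :> R by ring.
rewrite !mulr1 mulrA -mulrBl divr_gt0 ?den_gt0//.
have E1 : expR (- a * (20 / 3 - 4)) < 1 by rewrite expR_lt1; have := a0; lra.
have C1 := cos_le1 (pi / 3 : R).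
have : pi < a * sin (pi / 3) by rewrite -ltr_pdivrMr.
have wm0 : 0 < wm by rewrite /wm divr_gt0.
have := ltr_pM2r wm0 (expR (- a * (20 / 3 - 4))) 1; rewrite E1.
have := ler_pM2l wm0 (cos (pi / 3)) 1; rewrite C1.
by move: wm0; rewrite /wm; lra.
Qed.

Lemma cycle_exists c : 10 / 3 <= c < 4 -> exists t1 t2 t3 : R,
  [/\ 4 < t1 < 14 / 3, 6 < t2 < 20 / 3, 20 / 3 < t3 < 22 / 3,
      is_cycle c t1 t2 t3 &
      forall x0 y, pw_sol a (forcing wp) (forcing wm) x0 y -> x0 <= c ->
        y c = 0 -> forall x, c <= x <= 22 / 3 -> y x = sliding_orbit c t1 t2 t3 x].
Proof.
move=> c4.
have [|||||t1 [t1b t10 t1P]] := @relax_excursion _ a _ _ dp (10 / 3) c 4 (14 / 3).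
- lra.
- lra.
- lra.
- by move=> x xb; apply: (@forcing_p_gt0 5) => //; lra.
- by apply: (@relax_p_lt0 5 7) => //; rewrite ?/wp; [field | field | lra].
(* The downward excursion, treated as an upward one of the negated relaxation; the earliest start is
   4, where the forcing of the lower half plane changes sign. *)
have [|||||t2 [t2b t20 t2P]] := @relax_excursion _ a _ _ dmN 4 t1 6 (20 / 3).
- lra.
- lra.
- lra.
- by move=> x xb; rewrite /= oppr_gt0; apply: (@forcing_m_lt0 2) => //; lra.
- by rewrite relaxN oppr_lt0; exact: relax_m_gt0.
have [|||||t3 [t3b t30 t3P]] := @relax_excursion _ a _ _ dp 6 t2 (20 / 3) (22 / 3).
- lra.
- lra.
- lra.
- by move=> x xb; apply: (@forcing_p_gt0 9) => //; lra.
- by apply: (@relax_p_lt0 9 11) => //; rewrite ?/wp; [field | field | lra].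
have t2P' x : t1 < x < t2 -> relax a (steady a wm) t1 x < 0.
  by move=> /t2P; rewrite relaxN oppr_gt0.
have {}t20 : relax a (steady a wm) t1 t2 = 0.
  by apply: oppr_inj; rewrite -relaxN t20 oppr0.
exists t1, t2, t3; split => // x0 y sy x0c yc x xc.
(* The solution is now matched with the three excursions in turn: both forcings have the same sign
   just after [c], [t1] and [t2], so it crosses there and follows the new half plane. *)
have y1 : forall z, c <= z <= t1 -> y z = relax a (steady a wp) c z.
  apply: (pw_sol_relax dp sy x0c yc (m := 4)) => //; first lra.
  apply: (pw_sol_crossing a0 sy x0c) => // z zc.
  by split; [apply: (@forcing_p_gt0 5) | apply: (@forcing_m_gt0 1)] => //; lra.
have yt1 : y t1 = 0 by rewrite y1//; lra.
have y2 z : t1 <= z <= t2 -> y z = relax a (steady a wm) t1 z.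
  move=> zt; apply: oppr_inj; rewrite -relaxN.
  apply: (pw_sol_relax dmN (pw_solN sy) _ _ (m := 14 / 3) _ _ t2P) => //.
  - lra.
  - by rewrite /= yt1 oppr0.
  - lra.
  apply: (pw_sol_crossing a0 (pw_solN sy)) => /=.
  - lra.
  - move=> w wt; rewrite !oppr_gt0.
    by split; [apply: (@forcing_m_lt0 2) | apply: (@forcing_p_lt0 6)] => //; lra.
  - by rewrite yt1 oppr0.
have yt2 : y t2 = 0 by rewrite y2//; lra.
have y3 : forall z, t2 <= z <= t3 -> y z = relax a (steady a wp) t2 z.
  apply: (pw_sol_relax dp sy _ yt2 (m := 20 / 3)) => //; [lra|lra|].
  apply: (pw_sol_crossing a0 sy) => // [|z zc]; first lra.
  by split; [apply: (@forcing_p_gt0 9) | apply: (@forcing_m_gt0 3)] => //; lra.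
have yt3 : y t3 = 0 by rewrite y3//; lra.
(* On [(20 / 3, 22 / 3)] the upper forcing is negative and the lower one positive, so the axis
   attracts. *)
have y4 : forall z, t3 <= z <= 22 / 3 -> y z = 0.
  apply: (pw_sol_sliding a0 sy) => // [|z zc]; first lra.
  apply/andP; split; apply/ltW;
    [apply: (@forcing_p_lt0 10) | apply: (@forcing_m_gt0 3)] => //; lra.
rewrite /sliding_orbit; case: (leP x t1) => x1; first by apply: y1; lra.
case: (leP x t2) => x2; first by apply: y2; lra.
case: (leP x t3) => x3; first by apply: y3; lra.
by apply: y4; lra.
Qed.

Lemma slides_until_10_3 x0 y c : pw_sol a (forcing wp) (forcing wm) x0 y ->
  x0 <= c -> 8 / 3 < c < 10 / 3 -> y c = 0 -> y (10 / 3) = 0.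
Proof.
move=> sy x0c cb yc; apply: (pw_sol_sliding a0 sy x0c (d := 10 / 3)) => //; last lra.
move=> z zc; apply/andP; split; apply/ltW;
  [apply: (@forcing_p_lt0 4) | apply: (@forcing_m_gt0 1)] => //; lra.
Qed.

Lemma sliding_orbit_end c t1 t2 t3 x : t1 < x -> t2 < x -> t3 < x ->
  sliding_orbit c t1 t2 t3 x = 0.
Proof. by move=> h1 h2 h3; rewrite /sliding_orbit !leNgt h1 h2 h3. Qed.

Lemma sliding_20_3 x : 20 / 3 < x < 22 / 3 ->
  forcing wp x < 0 /\ 0 < forcing wm x.
Proof.
by move=> xb; split;
  [apply: (@forcing_p_lt0 10) | apply: (@forcing_m_gt0 3)] => //; lra.
Qed.

End sliding_cycle.

(** * Lebesgue primitives: increments controlled by a.e. bounds, and continuity *)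

Lemma ae_ge0_integral_ge0 (d : measure_display) (T : measurableType d)
    (R : realType) (mu : {measure set T -> \bar R}) (D : set T)
    (f : T -> \bar R) :
  measurable D -> measurable_fun D f ->
  {ae mu, forall x, D x -> (0 <= f x)%E} -> (0 <= \int[mu]_(x in D) f x)%E.
Proof.
move=> mD mf f0; rewrite integralE.
(* The negative part vanishes a.e., so only the positive part contributes. *)
have -> : (\int[mu]_(x in D) f^\- x = \int[mu]_(x in D) cst 0 x)%E.
  apply: ae_eq_integral => //; first exact: measurable_funeneg.
  apply: filterS f0 => x fx Dx /=.
  by rewrite funenegE; apply/max_idPr; rewrite oppe_le0 fx.
by rewrite integral_cst// mul0e sube0 integral_ge0.
Qed.

Definition primitive_from (R : realType) (x0 : R) (g y : R -> R) : Prop :=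
  forall x, x0 <= x ->
    (@lebesgue_measure R).-integrable `[x0, x] (EFin \o g) /\
    ((y x - y x0)%:E = \int[@lebesgue_measure R]_(s in `[x0, x]) (g s)%:E)%E.

Section primitive_from_theory.
Context {R : realType}.
Local Notation mu := (@lebesgue_measure R).
Implicit Types (x w z l : R) (g y : R -> R).

Lemma ae_lebesgueS (P Q : R -> Prop) : (forall s, P s -> Q s) ->
  {ae mu, forall s, P s} -> {ae mu, forall s, Q s}.
Proof.
by move=> PQ; apply: filterS; first exact: (ae_filter_ringOfSetsType mu).
Qed.

Lemma primitive_fromN x0 g y :
  primitive_from x0 g y -> primitive_from x0 (\- g) (\- y).
Proof.
move=> Py x /Py[ig yE]; split; first exact: integrableN ig.
rewrite /= opprK addrC -opprB EFinN yE -integralN//.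
exact: integrable_add_def.
Qed.

Lemma primitive_from_ext x0 g y y' : (forall x, x0 <= x -> y' x = y x) ->
  primitive_from x0 g y -> primitive_from x0 g y'.
Proof. by move=> yy' Py x x0x; rewrite !yy'//; exact: Py. Qed.

Lemma primitive_from_itv x0 g y w z : primitive_from x0 g y ->
  x0 <= w -> w <= z ->
  mu.-integrable `[w, z] (EFin \o g) /\
  y z - y w = \int[mu]_(s in `[w, z]) g s.
Proof.
move=> Py x0w wz; have x0z := le_trans x0w wz.
have [iz yz] := Py _ x0z; have [iw yw] := Py _ x0w.
have iwz : mu.-integrable `[w, z] (EFin \o g).
  by apply: integrableS iz => //; apply: subset_itvr; rewrite bnd_simp.
split=> //; rewrite -Rintegral_itv_obnd_cbnd; last first.
  by apply: integrableS iwz => //; apply: subset_itvr; rewrite bnd_simp.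
rewrite -(@Rintegral_itvB _ g (BLeft x0)) ?bnd_simp//.
by rewrite /Rintegral -yz -yw /=; ring.
Qed.

(** Integrates [g - l], nonnegative a.e.; this is how a.e. information on the slope becomes a
    statement about [y] at every point. *)
Lemma primitive_from_incr_ge x0 g y w z l : primitive_from x0 g y ->
  x0 <= w -> w <= z -> {ae mu, forall s, w <= s <= z -> l <= g s} ->
  l * (z - w) <= y z - y w.
Proof.
move=> Py x0w wz lg; have [ig yE] := primitive_from_itv Py x0w wz.
have il : mu.-integrable `[w, z] (EFin \o cst l).
  apply: continuous_compact_integrable; first exact: segment_compact.
  by apply: continuous_subspaceT => x; exact: cvg_cst.
have muwz : (mu `[w, z]%classic = (z - w)%:E)%E.
  rewrite lebesgue_measure_itv /= lte_fin; case: ltP => // zw.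
  by congr EFin; lra.
have := @RintegralB _ _ _ mu `[w, z]%classic g (cst l) _ ig il.
rewrite -yE Rintegral_cst//= muwz /= => E.
rewrite -subr_ge0 -E//; apply: fine_ge0; apply: ae_ge0_integral_ge0 => //.
  by apply: (measurable_int mu); exact: (integrableB _ ig il).
apply: ae_lebesgueS lg => s lg /=; rewrite in_itv /= => /lg; rewrite lee_fin.
by rewrite subr_ge0.
Qed.

Lemma primitive_from_incr_le x0 g y w z l : primitive_from x0 g y ->
  x0 <= w -> w <= z -> {ae mu, forall s, w <= s <= z -> g s <= l} ->
  y z - y w <= l * (z - w).
Proof.
move=> Py x0w wz gl.
have := @primitive_from_incr_ge _ _ _ _ _ (- l) (primitive_fromN Py) x0w wz.
rewrite /= mulNr -opprD lerN2; apply.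
by apply: ae_lebesgueS gl => s gl /gl; rewrite lerN2.
Qed.

Lemma primitive_from_continuous x0 g y : primitive_from x0 g y ->
  continuous (fun x => y (Num.max x x0)).
Proof.
(* One unit of room to the right keeps all points within distance 1 inside [[x0, b]], where the
   indefinite integral is continuous. *)
move=> Py x; pose b := Num.max x x0 + 1.
have x0m (z : R) : x0 <= Num.max z x0 by rewrite le_max lexx orbT.
have x0b : x0 <= b by rewrite /b; have := x0m x; lra.
have [ib _] := Py b x0b.
have /subspace_continuousP/(_ (Num.max x x0)) :=
  parameterized_integral_continuous x0b ib.
have /[swap] /[apply] : `[x0, b]%classic (Num.max x x0).
  by rewrite /= in_itv /= x0m /b; lra.
move=> cI; apply/cvgrPdist_lt => e e0.
move/cvgrPdist_lt : cI => /(_ _ e0)[d /= d0 dP].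
have m0 : 0 < Num.min d 1 by rewrite lt_min d0 ltr01.
exists (Num.min d 1) => // z /=; rewrite lt_min => /andP[xzd xz1].
have maxB : `|Num.max x x0 - Num.max z x0| <= `|x - z|.
  have h1 := ler_norm (x - z); have h2 := ler_norm (z - x).
  rewrite distrC in h2; have h3 := normr_ge0 (x - z).
  by case: (leP x x0) => h4; case: (leP z x0) => h5; rewrite ler_norml; lra.
have := dP (Num.max z x0) (le_lt_trans maxB xzd) _.
have IE w : x0 <= w -> parameterized_integral mu x0 w g = y w - y x0.
  by move=> /Py[_ E]; rewrite /parameterized_integral /Rintegral -E.
rewrite /from_subspace /= !IE//.
have -> (r s t : R) : r - t - (s - t) = r - s by ring.
apply; rewrite in_itv /= x0m /b; move: (le_lt_trans maxB xz1).
by rewrite ltr_norml; lra.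
Qed.

End primitive_from_theory.

(** * From the a.e. differential inclusion to pointwise derivatives and crossings *)

Lemma is_derive_slopes (R : realType) (y : R -> R) (x D : R) :
  (forall e, 0 < e -> exists2 d, 0 < d & forall w z,
     x - d < w -> w <= z -> z < x + d ->
     (D - e) * (z - w) <= y z - y w <= (D + e) * (z - w)) ->
  is_derive x 1 y D.
Proof.
move=> H.
(* The difference quotient is the slope of a chord ending at [x], taken as [(x, x + h)] or
   [(x + h, x)] according to the sign of [h]. *)
have cv : (h^-1 *: ((y \o shift x) (h *: (1 : R)) - y x) @[h --> 0^'] --> D)%classic.
  apply/cvgrPdist_le => e e0; have [d d0 dP] := H e e0.
  exists d => //= h; rewrite /ball /= sub0r normrN => hd h0.
  have -> : h *: (1 : R) + x = x + h by rewrite /GRing.scale /= mulr1 addrC.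
  rewrite /GRing.scale /=.
  have hE : h * (h^-1 * (y (x + h) - y x)) = y (x + h) - y x.
    by rewrite mulrA divff// mul1r.
  set q := _^-1 * _ in hE *.
  move: hd; rewrite ltr_norml ler_norml => hd.
  have [hp|hn|hz] := ltgtP 0 h; last by rewrite -hz eqxx in h0.
  - have := dP x (x + h); rewrite -hE => /(_ _ _ _)/andP[]; [lra|lra|lra|].
    rewrite addrAC subrr add0r [h * q]mulrC !ler_pM2r//; lra.
  - have := dP (x + h) x; rewrite -(opprB (y _)) -hE.
    move=> /(_ _ _ _)/andP[]; [lra|lra|lra|].
    have -> : x - (x + h) = - h by ring.
    have -> : - (h * q) = q * - h by ring.
    rewrite !ler_pM2r ?oppr_gt0//; lra.
split; first by apply/cvg_ex; exists D.
exact: cvg_lim cv.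
Qed.

(** The weight [th] stands for [(1 + lam) / 2]; in this form reflection in [y = 0] is just
    [th -> 1 - th]. *)
Definition filippov_selection (R : realType) (a : R) (Fp Fm : R -> R)
    (y g : R -> R) (s : R) : Prop :=
  exists th : R, [/\ 0 <= th <= 1, 0 < y s -> th = 1, y s < 0 -> th = 0 &
    g s = th * Fp s + (1 - th) * Fm s - a * y s].

(** Near a point with [y > 0], [g] is a.e. the continuous function [Fp - a y], so all nearby chords
    have almost its slope. At a zero where both forcings are positive, every convex combination
    exceeds some [m > 0] nearby, so [y] was negative just before. *)
Lemma upper_sol_primitive (R : realType) (a : R) (Fp Fm : R -> R) (x0 : R)
    (g y : R -> R) :
  continuous Fp -> continuous Fm -> continuous y -> primitive_from x0 g y ->
  {ae @lebesgue_measure R, forall s, x0 <= s ->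
     filippov_selection a Fp Fm y g s} ->
  upper_sol a Fp Fm x0 y.
Proof.
move=> cFp cFm cy Py gae.
have cF (F : R -> R) : continuous F -> continuous (fun s => F s - a * y s).
  move=> cF s; apply: cvgB; first exact: cF.
  by apply: cvgM; [exact: cvg_cst | exact: cy].
have cN : continuous (fun s => - (Fp s - a * y s)).
  by move=> s; apply: cvgN; exact: cF.
split=> x x0x yx.
  apply: is_derive_slopes => e e0.
  have [d1 d10 d1P] := continuous_near_gt (cy x) yx.
  have [|d2 d20 d2P] := continuous_near_gt (cF _ cFp x)
    (l := Fp x - a * y x - e); first lra.
  have [|d3 d30 d3P] := continuous_near_gt (cN x)
    (l := - (Fp x - a * y x) - e); first lra.
  pose d := Num.min (Num.min d1 d2) (Num.min d3 (x - x0)).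
  have [dd1 dd2 dd3 dd0] : [/\ d <= d1, d <= d2, d <= d3 & d <= x - x0].
    by rewrite /d !ge_min !lexx !orbT.
  exists d; first by rewrite /d !lt_min; lra.
  move=> w z xw wz zx; have gE : {ae @lebesgue_measure R, forall s,
      w <= s <= z -> g s = Fp s - a * y s}.
    apply: ae_lebesgueS gae => s gs wsz.
    have [|th [_ th1 _ ->]] := gs; first lra.
    by rewrite th1; [ring | apply: d1P; lra].
  apply/andP; split.
    apply: (primitive_from_incr_ge Py) => //; first lra.
    apply: ae_lebesgueS gE => s gs wsz; rewrite gs//; have := d2P s; lra.
  apply: (primitive_from_incr_le Py) => //; first lra.
  apply: ae_lebesgueS gE => s gs wsz; rewrite gs//; have := d3P s; lra.
move=> Fpx Fmx; pose m := Num.min (Fp x) (Fm x) / 2.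
have m0 : 0 < m by rewrite /m divr_gt0// lt_min Fpx.
have [mp mm] : m * 2 <= Fp x /\ m * 2 <= Fm x.
  by rewrite /m divfK// !ge_min !lexx orbT.
have [|d1 d10 d1P] := continuous_near_gt (cF _ cFp x) (l := m).
  by rewrite yx; lra.
have [|d2 d20 d2P] := continuous_near_gt (cF _ cFm x) (l := m).
  by rewrite yx; lra.
pose d := Num.min (Num.min d1 d2) (x - x0).
have [dd1 dd2 dd0] : [/\ d <= d1, d <= d2 & d <= x - x0].
  by rewrite /d !ge_min !lexx !orbT.
exists d; first by rewrite /d !lt_min; lra.
move=> z zx; have : m * (x - z) <= y x - y z.
  apply: (primitive_from_incr_ge Py); [lra|lra|].
  apply: ae_lebesgueS gae => s gs zsx; have [|th [th01 _ _ ->]] := gs; first lra.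
  have h1 : m < Fp s - a * y s by apply: d1P; lra.
  have h2 : m < Fm s - a * y s by apply: d2P; lra.
  nra.
have : 0 < m * (x - z) by rewrite mulr_gt0// subr_gt0; lra.
rewrite yx; lra.
Qed.

(** * Reduction of Filippov solutions to the two forcings, and forward uniqueness from [10 / 3] *)

Section existence_and_uniqueness.
Context {R : realType}.
Local Notation mu := (@lebesgue_measure R).
Local Notation Fp := (forcing (3 * pi / 2 : R)).
Local Notation Fm := (forcing (pi / 2 : R)).

(** Since [sin (3 u) = (1 + 2 cos (2 u)) sin u] with [u = pi x / 2], the field is affine in [lam]
    between the two pure sine forcings. *)
Lemma rhsE (a lam x y : R) :
  rhs a lam x y =
    (1 + lam) / 2 * Fp x + (1 - (1 + lam) / 2) * Fm x - a * y.
Proof.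
rewrite /rhs /forcing; set u := pi / 2 * x.
have -> : pi * x / 2 = u by rewrite /u; field.
have -> : pi * x = u *+ 2 by rewrite /u; field.
have -> : 3 * pi / 2 * x = u *+ 2 + u by rewrite /u; field.
by rewrite sinD sin_mulr2n cos_mulr2n; field.
Qed.

Lemma continuous_forcing (w : R) : continuous (forcing w).
Proof.
move=> x; apply: cvgN; apply: (@continuous_comp _ _ _ ( *%R w) sin).
  exact: mulrl_continuous.
exact: continuous_sin.
Qed.

Lemma forcing_p_periodic (n : nat) (x : R) : Fp (x + 4 * n%:R) = Fp x.
Proof.
rewrite /forcing; have -> : 3 * pi / 2 * (x + 4 * n%:R) =
  3 * pi / 2 * x + pi *+ (6 * n) by rewrite -(mulr_natr pi) natrM; field.
by rewrite (alternatingn (@sinDpi R)) -signr_odd oddM /= expr0 mul1r.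
Qed.

Lemma forcing_m_periodic (n : nat) (x : R) : Fm (x + 4 * n%:R) = Fm x.
Proof.
rewrite /forcing; have -> : pi / 2 * (x + 4 * n%:R) =
  pi / 2 * x + pi *+ (2 * n) by rewrite -(mulr_natr pi) natrM; field.
by rewrite (alternatingn (@sinDpi R)) -signr_odd oddM /= expr0 mul1r.
Qed.

(* Freezing [y] at [y x0] to the left of [x0] makes it continuous on all of [R]. *)
Lemma filippov_pw_sol (a x0 : R) (y : R -> R) : filippov_sol a x0 y ->
  pw_sol a Fp Fm x0 (fun x => y (Num.max x x0)).
Proof.
move=> [g [ig [yE gae]]].
have Py : primitive_from x0 g y by move=> x x0x; split; [exact: ig | exact: yE].
have cy := primitive_from_continuous Py.
have {}Py : primitive_from x0 g (fun x => y (Num.max x x0)).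
  by apply: primitive_from_ext Py => x x0x; rewrite (max_idPl x0x).
have selP s : (x0 <= s -> exists lam, admissible lam (y s) /\
      g s = rhs a lam s (y s)) ->
    x0 <= s -> exists th, [/\ 0 <= th <= 1, 0 < y s -> th = 1,
      y s < 0 -> th = 0 & g s = th * Fp s + (1 - th) * Fm s - a * y s].
  move=> H /H[lam [adm ->]]; exists ((1 + lam) / 2); rewrite rhsE; split=> //.
  - by case: adm => [[_ ->]|[[_ ->]|[_ lamb]]]; lra.
  - by case: adm => [[_ ->]|[[? _]|[? _]]] ?; lra.
  - by case: adm => [[? _]|[[_ ->]|[? _]]] ?; lra.
split=> //.
- apply: (upper_sol_primitive _ _ cy Py); try exact: continuous_forcing.
  apply: ae_lebesgueS gae => s /selP h x0s; have [th thP] := h x0s.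
  by exists th; rewrite /= (max_idPl x0s).
- have cN (f : R -> R) : continuous f -> continuous (\- f).
    by move=> cf x; apply: cvgN; exact: cf.
  apply: (upper_sol_primitive _ _ (cN _ cy) (primitive_fromN Py));
    try exact/cN/continuous_forcing.
  apply: ae_lebesgueS gae => s /selP h x0s; have [th [th01 th1 th0 gE]] := h x0s.
  exists (1 - th); rewrite /= (max_idPl x0s) oppr_gt0 oppr_lt0; split.
  - by lra.
  - by move=> /th0 ->; rewrite subr0.
  - by move=> /th1 ->; rewrite subrr.
  - by rewrite gE; ring.
Qed.

(** Over one period both solutions follow the same orbit and are back at 0 at [22 / 3], so they can
    be shifted by 4. The starting points [x1], [x2] vary in the induction because the shift moves
    them too. *)
Lemma pw_sol_agree (a : R) (n : nat) (x1 x2 : R) (y1 y2 : R -> R) :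
  pi / sin (pi / 3) < a ->
  pw_sol a Fp Fm x1 y1 -> pw_sol a Fp Fm x2 y2 ->
  x1 <= 10 / 3 -> x2 <= 10 / 3 -> y1 (10 / 3) = 0 -> y2 (10 / 3) = 0 ->
  forall x, 10 / 3 <= x <= 10 / 3 + 4 * n%:R -> y1 x = y2 x.
Proof.
move=> al; elim: n x1 x2 y1 y2 => [|n IH] x1 x2 y1 y2 s1 s2 x1b x2b y10 y20 x.
  rewrite mulr0 addr0 => xb; have -> : x = 10 / 3 by lra.
  by rewrite y10 y20.
rewrite -(natr1 n) => xb.
have [|t1 [t2 [t3 [t1b t2b t3b _ H]]]] := cycle_exists al (c := 10 / 3); first lra.
have {H}Y (x0 : R) y : pw_sol a Fp Fm x0 y -> x0 <= 10 / 3 -> y (10 / 3) = 0 ->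
    forall x, 10 / 3 <= x <= 22 / 3 -> y x = sliding_orbit a (10 / 3) t1 t2 t3 x.
  by move=> s x0b y0; apply: H s x0b y0.
have [x22|x22] := lerP x (22 / 3).
  have x22' : 10 / 3 <= x <= 22 / 3 by lra.
  by rewrite (Y _ _ s1 x1b y10 _ x22') (Y _ _ s2 x2b y20 _ x22').
have Y0 (x0 : R) y : pw_sol a Fp Fm x0 y -> x0 <= 10 / 3 -> y (10 / 3) = 0 ->
    y (10 / 3 + 4) = 0.
  move=> s x0b y0; have -> : 10 / 3 + 4 = 22 / 3 :> R by lra.
  by rewrite (Y _ _ s x0b y0) ?sliding_orbit_end//; lra.
have pp (z : R) : Fp (z + 4) = Fp z by have := forcing_p_periodic 1 z; rewrite mulr1.
have pm (z : R) : Fm (z + 4) = Fm z by have := forcing_m_periodic 1 z; rewrite mulr1.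
have -> : x = (x - 4) + 4 by ring.
apply: (IH _ _ _ _ (pw_sol_shift pp pm s1) (pw_sol_shift pp pm s2));
  [lra | lra | exact: Y0 s1 _ _ | exact: Y0 s2 _ _ | lra].
Qed.


(** * Gluing primitives over adjacent intervals *)

Definition primitive_on (c d : R) (g y : R -> R) : Prop :=
  mu.-integrable `[c, d] (EFin \o g) /\ forall x, c <= x <= d ->
    ((y x - y c)%:E = \int[mu]_(s in `[c, x]) (g s)%:E)%E.

(** The fundamental theorem of calculus, with [g] free at the two endpoints, where the slope of the
    glued orbit may jump. *)
Lemma primitive_on_C1 (c d : R) (Y G y g : R -> R) : c < d -> continuous G ->
  (forall x : R, is_derive x 1 Y (G x)) ->
  (forall x, c <= x <= d -> y x = Y x) -> (forall x, c < x < d -> g x = G x) ->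
  primitive_on c d g y.
Proof.
move=> cd cG dY yY gG; have cY := is_derive_continuous dY.
have mg (z : R) : z <= d -> measurable_fun `]c, z[%classic g.
  move=> zd; apply: (@eq_measurable_fun _ _ _ _ _ G).
    by move=> x; rewrite inE /= in_itv /= => xcz; rewrite gG//; lra.
  by apply: measurable_funTS; exact: continuous_measurable_fun.
have iG (z : R) : mu.-integrable `[c, z] (EFin \o G).
  apply: continuous_compact_integrable; first exact: segment_compact.
  exact: continuous_subspaceT.
(* Endpoints are null sets. The outer function [h] is the absolute value for integrability and the
   identity for the integral. *)
have intE (h : \bar R -> \bar R) (z : R) : z <= d ->
    measurable_fun setT h ->
    (\int[mu]_(s in `[c, z]) h (g s)%:E = \int[mu]_(s in `[c, z]) h (G s)%:E)%E.
  move=> zd mh; have mhF (F : R -> R) : measurable_fun `]c, z[%classic F ->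
      measurable_fun `]c, z[%classic (fun s => h (F s)%:E).
    by move=> mF; apply: (measurableT_comp mh); exact/measurable_EFinP.
  have mG : measurable_fun `]c, z[%classic G.
    by apply: measurable_funTS; exact: continuous_measurable_fun.
  rewrite (integral_itv_bndoo true false (mhF _ (mg _ zd))).
  rewrite (integral_itv_bndoo true false (mhF _ mG)).
  by apply: eq_integral => x; rewrite inE /= in_itv /= => xcz; rewrite gG//; lra.
split.
  apply/integrableP; split.
    by apply/measurable_EFinP; apply: measurable_fun_itv_cc; exact: mg.
  have /integrableP[_] := iG d; rewrite -(intE abse)//.
move=> x xcd; rewrite (intE id)//; last lra.
rewrite !yY; [|lra|lra].
have [cx|xc] := ltP c x; last first.
  have -> : x = c by lra.
  by rewrite subrr set_itv1 integral_set1.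
rewrite (@continuous_FTC2 _ G Y)//.
- exact: continuous_subspaceT.
- split.
  + by move=> z _; exact: (@ex_derive _ _ _ _ _ _ _ (dY z)).
  + by apply: cvg_at_right_filter; exact: cY.
  + by apply: cvg_at_left_filter; exact: cY.
- by move=> z _; rewrite derive1E; exact: (@derive_val _ _ _ _ _ _ _ (dY z)).
Qed.

Lemma primitive_on_cat (c d e : R) (g y : R -> R) : c <= d -> d <= e ->
  primitive_on c d g y -> primitive_on d e g y -> primitive_on c e g y.
Proof.
move=> cd de [icd ycd] [ide yde].
have split_itv (x : R) : d <= x ->
    (`[c, x] = `[c, d] `|` `]d, x])%classic.
  by move=> dx; rewrite -itv_bndbnd_setU// bnd_simp.
have ioc (x : R) : x <= e -> mu.-integrable `]d, x] (EFin \o g).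
  move=> xe; apply: integrableS ide => // z /=; rewrite !in_itv /=; lra.
have mU (x : R) : d <= x <= e -> measurable_fun (`[c, d] `|` `]d, x])%classic g.
  move=> dxe; apply/measurable_funU => //; split; apply/measurable_EFinP.
    exact: measurable_int icd.
  by apply: (measurable_int mu); apply: ioc; lra.
have disj (x : R) : [disjoint `[c, d]%classic & `]d, x]%classic]%classic.
  by apply/disj_setPS => z [] /=; rewrite !in_itv /=; lra.
split.
  apply/integrableP; split.
    rewrite (split_itv e de); apply/measurable_EFinP; apply: mU; lra.
  rewrite (split_itv e de) ge0_integral_setU//=.
  - rewrite lte_add_pinfty//; first by have /integrableP[] := icd.
    by have /integrableP[] := ioc e (lexx e).
  - have mg : measurable_fun (`[c, d] `|` `]d, e])%classic g by apply: mU; lra.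
    have mng := measurableT_comp (@normr_measurable R setT) mg.
    by apply/measurable_EFinP; exact: mng.
move=> x xce; have [xd|dx] := leP x d; first by apply: ycd; lra.
rewrite (split_itv x (ltW dx)) integral_setU//; last first.
  by apply/measurable_EFinP; apply: mU; lra.
rewrite -ycd; last lra.
rewrite integral_itv_obnd_cbnd; last first.
  by apply: (measurable_int mu); apply: ioc; lra.
by rewrite -yde ?(ltW dx)//; [rewrite -EFinD; congr EFin; ring | lra].
Qed.

Lemma primitive_fromP (x0 : R) (g y : R -> R) :
  (forall n : nat, primitive_on x0 (x0 + 4 * n%:R) g y) -> primitive_from x0 g y.
Proof.
move=> H x x0x; have [n xn] : exists n : nat, x <= x0 + 4 * n%:R.
  exists (Num.truncn (x - x0)).+1; have := truncnS_gt (x - x0).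
  set k := _.+1%:R; have : 0 <= k by exact: ler0n.
  lra.
have [i yE] := H n; split; last by apply: yE; rewrite x0x.
by apply: integrableS i => // z /=; rewrite !in_itv /=; lra.
Qed.


Lemma pw_sol_unique (a : R) (x1 x2 : R) (y1 y2 : R -> R) :
  pi / sin (pi / 3) < a ->
  pw_sol a Fp Fm x1 y1 -> pw_sol a Fp Fm x2 y2 ->
  x1 <= 10 / 3 -> x2 <= 10 / 3 -> y1 (10 / 3) = 0 -> y2 (10 / 3) = 0 ->
  forall x, 10 / 3 <= x -> y1 x = y2 x.
Proof.
move=> al s1 s2 x1b x2b y10 y20 x xb; pose n := (Num.truncn (x - 10 / 3)).+1.
apply: (pw_sol_agree (n := n) al s1 s2) => //; rewrite xb /=.
have := truncnS_gt (x - 10 / 3); rewrite -/n.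
have : 0 <= n%:R :> R by exact: ler0n.
lra.
Qed.

Lemma primitive_on_shifted_relax (a c d : R) (n : nat) (F p y g : R -> R) :
  (forall x : R, is_derive x 1 p (F x - a * p x)) -> continuous F ->
  (forall x, F (x + 4 * n%:R) = F x) -> c < d ->
  (forall x, c <= x <= d -> y (x + 4 * n%:R) = relax a p c x) ->
  (forall x, c < x < d -> g (x + 4 * n%:R) = F x - a * relax a p c x) ->
  primitive_on (c + 4 * n%:R) (d + 4 * n%:R) g y.
Proof.
set T := 4 * n%:R => dp cF FT cd yE gE.
have shiftE (x : R) : x = (x - T) + T by ring.
have dS (x : R) : is_derive x 1 (fun x => relax a p c (x - T))
    (F x - a * relax a p c (x - T)).
  have dT : is_derive x 1 (fun x : R => x - T) 1 by apply: is_derive_eq (subr0 _).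
  have := @is_derive1_comp _ (relax a p c) (fun x => x - T) x _ _
    (is_derive_relax dp c (x - T)) dT.
  by rewrite mulr1 -(FT (x - T)) -shiftE.
apply: (primitive_on_C1 _ _ dS); first by lra.
- move=> x; apply: cvgB; first exact: cF.
  apply: cvgM; [exact: cvg_cst | exact: is_derive_continuous dS x].
- by move=> x xb; rewrite [in LHS](shiftE x) yE//; lra.
- by move=> x xb; rewrite [in LHS](shiftE x) gE -?(FT (x - T)) -?shiftE//; lra.
Qed.

(** * Periodic extension, and the cycle as a Filippov solution *)

Definition repeat4 (phi : R -> R) (x : R) : R :=
  phi (x - 4 * (Num.truncn ((x - 10 / 3) / 4))%:R).

Lemma repeat4E (phi : R -> R) (n : nat) (x : R) : phi (22 / 3) = phi (10 / 3) ->
  10 / 3 <= x <= 22 / 3 -> repeat4 phi (x + 4 * n%:R) = phi x.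
Proof.
move=> phiE xb; rewrite /repeat4; have [x22|x22] := ltP x (22 / 3).
  have E : n%:R <= (x + 4 * n%:R - 10 / 3) / 4 < n.+1%:R.
    by rewrite -(natr1 n); lra.
  by rewrite (truncn_def E); congr phi; ring.
(* At the right end the count of elapsed periods is already [n + 1]; equality of [phi] at both ends
   reconciles the two. *)
have -> : x = 22 / 3 by lra.
have E : (n.+1%:R : R) <= (22 / 3 + 4 * n%:R - 10 / 3) / 4 < (n.+2%:R : R).
  by rewrite -[n.+2]addn2 -[n.+1]addn1 !natrD; lra.
rewrite (truncn_def E).
by rewrite phiE -(natr1 n); congr phi; lra.
Qed.

Lemma repeat4_period (phi : R -> R) : phi (22 / 3) = phi (10 / 3) ->
  periodic_on (10 / 3) 4 (repeat4 phi).
Proof.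
move=> phiE x xb; pose n := Num.truncn ((x - 10 / 3) / 4).
have xn : n%:R <= (x - 10 / 3) / 4 < n.+1%:R by apply: truncn_itv; lra.
rewrite -(natr1 n) in xn.
have -> : x + 4 = (x - 4 * n%:R) + 4 * n.+1%:R by rewrite -(natr1 n); ring.
rewrite [in RHS](_ : x = (x - 4 * n%:R) + 4 * n%:R); last by ring.
by rewrite !repeat4E//; lra.
Qed.

(** A selection valid at every point: 0 on attracting sliding, and at other zeros the filler value
    given by [lam = 0]. *)
Definition canonical_slope (a : R) (y : R -> R) (x : R) : R :=
  if 0 < y x then Fp x - a * y x else
  if y x < 0 then Fm x - a * y x else
  if (Fp x < 0) && (0 < Fm x) then 0 else (Fp x + Fm x) / 2.

Lemma canonical_slope_admissible (a : R) (y : R -> R) (x : R) :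
  exists lam, admissible lam (y x) /\ canonical_slope a y x = rhs a lam x (y x).
Proof.
rewrite /canonical_slope; have [y0|y0|y0] := ltgtP 0 (y x).
- by exists 1; split; [left | rewrite rhsE; field].
- by exists (-1); split; [right; left | rewrite rhsE; field].
rewrite -y0; case: ifPn => [/andP[Fp0 Fm0]|_]; last first.
  by exists 0; split; [right; right; split => //; lra | rewrite rhsE; field].
(* the sliding parameter, for which the vector field vanishes *)
exists ((Fp x + Fm x) / (Fm x - Fp x)); split.
  right; right; split => //; rewrite ltr_pdivlMr ?ltr_pdivrMr; lra.
by rewrite rhsE; field; lra.
Qed.

Lemma sliding_cycle_sol (a t1 t2 t3 : R) : pi / sin (pi / 3) < a ->
  4 < t1 < 14 / 3 -> 6 < t2 < 20 / 3 -> 20 / 3 < t3 < 22 / 3 ->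
  is_cycle a (10 / 3) t1 t2 t3 ->
  let yp := repeat4 (sliding_orbit a (10 / 3) t1 t2 t3) in
  [/\ sol_from a (10 / 3) yp, periodic_on (10 / 3) 4 yp & sliding (10 / 3) yp].
Proof.
move=> al t1b t2b t3b [[t10 p1] [t20 p2] [t30 p3]].
set phi := sliding_orbit _ _ _ _ _ => yp.
have a0 : 0 < a.
  apply: lt_trans al; rewrite divr_gt0 ?pi_gt0//; apply: sin_gt0_pi.
  by have := pi_gt0 R; lra.
have phi1 x : 10 / 3 <= x <= t1 ->
    phi x = relax a (steady a (3 * pi / 2)) (10 / 3) x.
  by move=> xb; rewrite /phi /sliding_orbit; case: leP => // ?; lra.
have phi2 x : t1 <= x <= t2 -> phi x = relax a (steady a (pi / 2)) t1 x.
  move=> xb; rewrite /phi /sliding_orbit; case: leP => [?|?].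
    have -> : x = t1 by lra.
    by rewrite t10 relaxcc.
  by case: leP => // ?; lra.
have phi3 x : t2 <= x <= t3 -> phi x = relax a (steady a (3 * pi / 2)) t2 x.
  move=> xb; rewrite /phi /sliding_orbit; case: leP => [?|?]; first lra.
  case: leP => [?|?]; last by case: leP => // ?; lra.
  have -> : x = t2 by lra.
  by rewrite t20 relaxcc.
have phi4 x : t3 <= x <= 22 / 3 -> phi x = 0.
  move=> xb; rewrite /phi /sliding_orbit; case: leP => [?|?]; first lra.
  case: leP => [?|?]; first lra.
  case: leP => // ?; have -> : x = t3 by lra.
  exact: t30.
have phi0 : phi (10 / 3) = 0 by rewrite phi1 ?relaxcc//; lra.
have phiE : phi (22 / 3) = phi (10 / 3) by rewrite phi0 phi4//; lra.
have ypE n x : 10 / 3 <= x <= 22 / 3 -> yp (x + 4 * n%:R) = phi x.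
  exact: repeat4E.
have dp w (x : R) : is_derive x 1 (steady a w) (forcing w x - a * steady a w x).
  by apply: is_derive_steady; rewrite gt_eqF.
pose g := canonical_slope a yp.
have gp n x : 10 / 3 <= x <= 22 / 3 -> 0 < phi x ->
    g (x + 4 * n%:R) = Fp x - a * phi x.
  move=> xb phi0'; rewrite /g /canonical_slope ypE// phi0'.
  by rewrite forcing_p_periodic.
have gm n x : 10 / 3 <= x <= 22 / 3 -> phi x < 0 ->
    g (x + 4 * n%:R) = Fm x - a * phi x.
  move=> xb phi0'; rewrite /g /canonical_slope ypE// ltNge (ltW phi0') /= phi0'.
  by rewrite forcing_m_periodic.
(* One period consists of the three excursions, glued at [t1] and [t2], and the sliding phase from
   [t3] on. *)
have piece n : primitive_on (10 / 3 + 4 * n%:R) (22 / 3 + 4 * n%:R) g yp.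
  apply: (@primitive_on_cat _ (t3 + 4 * n%:R)); [lra|lra| |].
  - apply: (@primitive_on_cat _ (t2 + 4 * n%:R)); [lra|lra| |].
    + apply: (@primitive_on_cat _ (t1 + 4 * n%:R)); [lra|lra| |].
      * apply: (primitive_on_shifted_relax (dp _)); first exact: continuous_forcing.
        - exact: forcing_p_periodic.
        - lra.
        - by move=> x xb; rewrite ypE ?phi1//; lra.
        - move=> x xb; rewrite -phi1; last lra.
          by apply: gp; [lra | rewrite phi1; [exact: p1 | lra]].
      * apply: (primitive_on_shifted_relax (dp _)); first exact: continuous_forcing.
        - exact: forcing_m_periodic.
        - lra.
        - by move=> x xb; rewrite ypE ?phi2//; lra.
        - move=> x xb; rewrite -phi2; last lra.
          by apply: gm; [lra | rewrite phi2; [exact: p2 | lra]].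
    + apply: (primitive_on_shifted_relax (dp _)); first exact: continuous_forcing.
      - exact: forcing_p_periodic.
      - lra.
      - by move=> x xb; rewrite ypE ?phi3//; lra.
      - move=> x xb; rewrite -phi3; last lra.
          by apply: gp; [lra | rewrite phi3; [exact: p3 | lra]].
  - apply: (@primitive_on_C1 _ _ (cst 0) (cst 0)); first lra.
    + by move=> x; exact: cvg_cst.
    + move=> x xb; have -> : x = (x - 4 * n%:R) + 4 * n%:R by ring.
      by rewrite ypE ?phi4//=; lra.
    + move=> x xb; have xE : x = (x - 4 * n%:R) + 4 * n%:R by ring.
      have [|Fp0 Fm0] := @sliding_20_3 R (x - 4 * n%:R); first lra.
      rewrite /g /canonical_slope xE forcing_p_periodic forcing_m_periodic.
      rewrite ypE ?phi4; [by rewrite !ltxx Fp0 Fm0 | lra | lra].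
split.
- split; last by rewrite -[X in yp X]addr0 -(mulr0 4) (ypE 0)//; lra.
  have Pg : primitive_from (10 / 3) g yp.
    apply: primitive_fromP; elim=> [|n IH]; last first.
      apply: (primitive_on_cat _ _ IH); [|lra|].
      - have : 0 <= n%:R :> R by exact: ler0n.
        lra.
      - have -> : 10 / 3 + 4 * n.+1%:R = 22 / 3 + 4 * n%:R :> R.
          by rewrite -(natr1 n); lra.
        exact: piece.
    rewrite mulr0 addr0; split.
      apply: integrableS (piece 0).1 => // x /=; rewrite !in_itv /=; lra.
    move=> x xb; have -> : x = 10 / 3 by lra.
    by rewrite subrr set_itv1 integral_set1.
  exists g; split; first by move=> x /Pg[].
  split; first by move=> x /Pg[].
  by apply: aeW => s _; exact: canonical_slope_admissible.
- exact: repeat4_period.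
- exists t3, (22 / 3); split; first lra.
  split; first lra.
  (* The index 3 gives the segment [(20 / 3, 22 / 3)], which contains [(t3, 22 / 3)]. *)
  move=> x xb; split; last by exists 3; lra.
  by rewrite -[x]addr0 -(mulr0 4) (ypE 0) ?phi4//; lra.
Qed.

End existence_and_uniqueness.

(** * Threshold, cycle, uniqueness and finite-time convergence *)

Theorem theorem2 (R : realType) :
  exists ah : R, 0 < ah /\
    forall a : R, ah < a ->
      exists yp : R -> R,
        sol_from a (10 / 3) yp /\ periodic_on (10 / 3) 4 yp /\ sliding (10 / 3) yp /\
        (forall y : R -> R, sol_from a (10 / 3) y -> forall x, 10 / 3 <= x -> y x = yp x) /\
        exists nu : R, 0 < nu /\
          forall xi : R,
            (8 / 3 < xi < 10 / 3 \/ 10 / 3 < xi < 10 / 3 + nu) ->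
            forall y : R -> R, sol_from a xi y ->
              exists X : R, forall x, X <= x -> y x = yp x.
Proof.
exists (pi / sin (pi / 3)); split.
  rewrite divr_gt0 ?pi_gt0//; apply: sin_gt0_pi; have := pi_gt0 R; lra.
move=> a al; have [|t1 [t2 [t3 [t1b t2b t3b cyc _]]]] :=
  cycle_exists al (c := 10 / 3); first lra.
have [solp perp slip] := sliding_cycle_sol al t1b t2b t3b cyc.
set yp := repeat4 _ in solp perp slip *.
pose hat (y : R -> R) (x0 x : R) := y (Num.max x x0).
have hatE y x0 x : x0 <= x -> hat y x0 x = y x by move=> ?; rewrite /hat (max_idPl _).
have sp : pw_sol a (forcing (3 * pi / 2)) (forcing (pi / 2)) (10 / 3)
    (hat yp (10 / 3)).
  exact: filippov_pw_sol solp.1.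
have hatp0 : hat yp (10 / 3) (10 / 3) = 0 by rewrite hatE//; exact: solp.2.
exists yp; do 3 split => //; split.
  move=> y [soly y0] x xb; rewrite -(hatE y (10 / 3))// -(hatE yp (10 / 3))//.
  apply: (pw_sol_unique al (filippov_pw_sol soly) sp) => //.
  exact: (etrans (hatE y _ _ _)).
(* [10 / 3 + 2 / 3 = 4] is the right end of the range of starts covered by [cycle_exists]. *)
exists (2 / 3); split; first lra.
move=> xi xib y [soly y0].
have sy : pw_sol a (forcing (3 * pi / 2)) (forcing (pi / 2)) xi (hat y xi).
  exact: filippov_pw_sol soly.
have haty0 : hat y xi xi = 0 by rewrite hatE.
have [xi10|xi10] : 8 / 3 < xi < 10 / 3 \/ 10 / 3 < xi < 4 by case: xib; lra.
  (* A start in the attracting segment slides to [10 / 3], and uniqueness applies from there. *)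
  exists (10 / 3) => x xb; rewrite -(hatE y xi); last lra.
  rewrite -(hatE yp (10 / 3))//.
  apply: (pw_sol_unique al sy sp) => //; first lra.
  exact: (slides_until_10_3 al sy (lexx xi) xi10).
have [|s1 [s2 [s3 [s1b s2b s3b _ H]]]] := cycle_exists al (c := xi); first lra.
have y22 : hat y xi (22 / 3) = 0.
  by rewrite (H _ _ sy (lexx xi) haty0) ?sliding_orbit_end//; lra.
(* A start after [10 / 3] is at 0 at [22 / 3]; shifted back by 4, it falls under uniqueness from
   [10 / 3]. *)
exists (22 / 3) => x xb.
have pp (z : R) : forcing (3 * pi / 2) (z + 4) = forcing (3 * pi / 2) z.
  by have := forcing_p_periodic 1 z; rewrite mulr1.
have pm (z : R) : forcing (pi / 2) (z + 4) = forcing (pi / 2) z.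
  by have := forcing_m_periodic 1 z; rewrite mulr1.
have xE : x = (x - 4) + 4 by ring.
rewrite -(hatE y xi); last lra.
rewrite xE perp; last lra.
rewrite -(hatE yp (10 / 3)); last lra.
apply: (pw_sol_unique al (pw_sol_shift pp pm sy) sp) => //; [lra| |lra].
by have -> : 10 / 3 + 4 = 22 / 3 :> R by lra.
Qed.
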